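(* Let $U$ be an open subset of a complex Banach space $E$ and let $v$ be a weight on $U$. Suppose that there exists a non-zero complex Banach space $F$ such that $H^\infty_v(U,F)$ has the $WH^\infty$-BPB property. Then $H^\infty_v(U)$ has the $WH^\infty$-BPB property.
   Context: Notation: $B_X$, $S_X$ are the closed unit ball and unit sphere of a Banach space $X$; $\mathbb{T}$ is the unit circle of $\mathbb{C}$. A weight on $U$ is a strictly positive continuous function on $U$. $H^\infty_v(U,F)$ is the Banach space of holomorphic mappings $f:U\to F$ with $\|f\|_v:=\sup\{v(z)\|f(z)\|: z\in U\}<\infty$; $H^\infty_v(U):=H^\infty_v(U,\mathbb{C})$. $G^\infty_v(U)$ is the space of all linear functionals on $H^\infty_v(U)$ whose restriction to $B_{H^\infty_v(U)}$ is continuous for the compact-open topology; it is a closed subspace of $H^\infty_v(U)^*$, with the norm of $H^\infty_v(U)^*$. For $z\in U$, $\delta_z\in G^\infty_v(U)$ is the evaluation $\delta_z(f)=f(z)$. $WH^\infty$-BPB property: $H^\infty_v(U,F)$ has the $WH^\infty$-BPB property if for every $0<\varepsilon<1$ there is $0<\eta(\varepsilon)<\varepsilon$ such that for every $f\in S_{H^\infty_v(U,F)}$, every $\lambda\in\mathbb{T}$ and every $z\in U$ with $v(z)\|f(z)\|>1-\eta(\varepsilon)$, there exist $f_0\in S_{H^\infty_v(U,F)}$, $\lambda_0\in\mathbb{T}$ and $z_0\in U$ such that $v(z_0)\|f_0(z_0)\|=1$, $\|f-f_0\|_v<\varepsilon$ and $\|\lambda v(z)\delta_z-\lambda_0v(z_0)\delta_{z_0}\|<\varepsilon$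 (the last norm being that of $G^\infty_v(U)$). For $H^\infty_v(U)$ this is the case $F=\mathbb{C}$. *)

(* Defs.v *)
From HB Require Import structures.
From mathcomp Require Import all_boot all_order all_algebra.
From mathcomp Require Import all_classical all_reals all_analysis.
From mathcomp Require Export complex.

Set Implicit Arguments.
Unset Strict Implicit.
Unset Printing Implicit Defensive.

Import Order.TTheory GRing.Theory Num.Theory.
Import numFieldNormedType.Exports.

Local Open Scope classical_set_scope.
Local Open Scope ring_scope.
Local Open Scope complex_scope.

(* The norm of a normed space over [R[i]] takes its values in [R[i]]; they are
   nonnegative, hence real, and [nrm] reads them in [R]. *)
Definition nrm (R : realType) (V : normedModType R[i]) (x : V) : R :=
  complex.Re `|x|.

Definition weight (R : realType) (E : normedModType R[i]) (U : set E)
    (v : E -> R) : Prop :=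
  (forall z, U z -> 0 < v z) /\ {within U, continuous v}.

(* A mapping [U -> F] is represented by a total function [E -> F]: everything
   below depends only on its values on the open set [U]. *)

Definition holomorphic_on (R : realType) (E F : normedModType R[i])
    (U : set E) (f : E -> F) : Prop :=
  forall z, U z -> differentiable f z.

Definition wvalues (R : realType) (E F : normedModType R[i]) (U : set E)
    (v : E -> R) (f : E -> F) : set R :=
  [set v z * nrm (f z) | z in U].

Definition Hinf (R : realType) (E F : normedModType R[i]) (U : set E)
    (v : E -> R) : set (E -> F) :=
  [set f | holomorphic_on U f /\ has_ubound (wvalues U v f)].

(* [sup] is 0 on the empty set, so that this is also the right norm when [U] is
   empty; it is meaningful for [f] in [Hinf U v] only. *)
Definition wnorm (R : realType) (E F : normedModType R[i]) (U : set E)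
    (v : E -> R) (f : E -> F) : R :=
  sup (wvalues U v f).

Definition Hinf_ball (R : realType) (E F : normedModType R[i]) (U : set E)
    (v : E -> R) : set (E -> F) :=
  [set f | Hinf U v f /\ wnorm U v f <= 1].

Definition Hinf_sphere (R : realType) (E F : normedModType R[i]) (U : set E)
    (v : E -> R) : set (E -> F) :=
  [set f | Hinf U v f /\ wnorm U v f = 1].

(* The compact-open topology on mappings defined on [U] is the topology of
   uniform convergence on the compact sets contained in [U]. *)
Definition compacts_in (T : topologicalType) (U : set T) : set (set T) :=
  [set K | compact K /\ K `<=` U].

(* Since the topology does not see values outside of [U] and the scalars are
   Hausdorff, such a functional takes equal values on functions of the space
   that agree on [U]. *)
Definition Ginf (R : realType) (E : normedModType R[i]) (U : set E)
    (v : E -> R) : set ((E -> R[i]^o) -> R[i]^o) :=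
  [set phi |
    (forall (a : R[i]) f g, Hinf U v f -> Hinf U v g ->
       phi (a \*: f \+ g) = a * phi f + phi g) /\
    {within (Hinf_ball U v : set {family compacts_in U, E -> R[i]^o}),
       continuous (phi : {family compacts_in U, E -> R[i]^o} -> R[i]^o)}].

(* The norm of the dual of [Hinf U v]; the set is bounded for [phi] in
   [Ginf U v]. *)
Definition Ginf_norm (R : realType) (E : normedModType R[i]) (U : set E)
    (v : E -> R) (phi : (E -> R[i]^o) -> R[i]^o) : R :=
  sup [set nrm (phi f) | f in Hinf_ball U v].

Definition delta (R : realType) (E : normedModType R[i]) (z : E)
    (f : E -> R[i]^o) : R[i]^o :=
  f z.

Lemma delta_Ginf (R : realType) (E : normedModType R[i]) (U : set E)
    (v : E -> R) (z : E) :
  U z -> Ginf U v (@delta R E z).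
Proof.
move=> Uz; split=> [//|].
apply: continuous_subspaceT => f.
have /fam_cvgP/(_ [set z]) :
    {family compacts_in U,
       nbhs (f : {family compacts_in U, E -> R[i]^o}) --> f} by exact: cvg_id.
rewrite uniform_set1; apply.
by split; [exact: compact_set1|move=> _ ->].
Qed.

Definition WHinf_BPB (R : realType) (E F : normedModType R[i]) (U : set E)
    (v : E -> R) : Prop :=
  forall eps : R, 0 < eps < 1 ->
  exists2 eta : R, 0 < eta < eps &
  forall (f : E -> F) (lambda : R[i]) (z : E),
    Hinf_sphere U v f -> `|lambda| = 1 -> U z -> v z * nrm (f z) > 1 - eta ->
  exists (f0 : E -> F) (lambda0 : R[i]) (z0 : E),
    [/\ Hinf_sphere U v f0, `|lambda0| = 1 & U z0] /\
    [/\ v z0 * nrm (f0 z0) = 1,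
        wnorm U v (f \- f0) < eps &
        Ginf_norm U v ((lambda * (v z)%:C) \*: @delta R E z
                       \- (lambda0 * (v z0)%:C) \*: @delta R E z0) < eps].

(* Main.v *)
(* Pick a unit vector [y] of [F] and apply the property of [F] to [z |-> f z *: y]
   with [eps / 2], which gives [f0], [lambda0] and [z0]. Let [psi] be a norming
   functional of [f0 z0] (Hahn-Banach) and [c] a unimodular scalar such that
   [c * psi y = |psi y|]. Then [h z = c * psi (f0 z)] attains its norm 1 at [z0],
   and [|f - h| <= (1 - |psi y|) + |f y - f0|], where both terms are at most
   [|f y - f0| < eps / 2].

   For the Hahn-Banach theorem no partial functional is extended: by Zorn's lemma
   there is a minimal sublinear functional below a given one, and a minimal
   sublinear functional is linear. *)
Require Import Defs.
From HB Require Import structures.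
From mathcomp Require Import all_boot all_order all_algebra.
From mathcomp Require Import all_classical all_reals all_analysis.
From mathcomp Require Import ring lra.
Set Implicit Arguments.
Unset Strict Implicit.
Unset Printing Implicit Defensive.

Import Order.TTheory GRing.Theory Num.Theory.
Import numFieldNormedType.Exports.

Local Open Scope classical_set_scope.
Local Open Scope ring_scope.
Local Open Scope complex_scope.

(** * Sublinear functionals and a real Hahn-Banach theorem *)

Definition sublinear (R : realType) (V : lmodType R) (p : V -> R) : Prop :=
  (forall x y, p (x + y) <= p x + p y) /\
  (forall t x, 0 <= t -> p (t *: x) = t * p x).

Section Sublinear.
Context {R : realType} {V : lmodType R}.
Implicit Types (p : V -> R) (x y a : V) (t s : R).

Lemma sublinear0 p : sublinear p -> p 0 = 0.
Proof. by case=> _ pZ; rewrite -(scale0r 0) pZ// mul0r. Qed.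

Lemma sublinear_opp p x : sublinear p -> - p (- x) <= p x.
Proof.
by move=> sp; have := sp.1 x (- x); rewrite subrr sublinear0//; lra.
Qed.

(* The converse inequality follows by applying this one to the inverse scalar. *)
Lemma sublinearP p : p 0 = 0 -> (forall x y, p (x + y) <= p x + p y) ->
  (forall t x, 0 < t -> p (t *: x) <= t * p x) -> sublinear p.
Proof.
move=> p0 pD pZ; split=> // t x; rewrite le_eqVlt => /orP[/eqP<-|t0].
  by rewrite scale0r mul0r.
apply/eqP; rewrite eq_le pZ//=.
have /(pZ _ (t *: x)) : 0 < t^-1 by rewrite invr_gt0.
by rewrite scalerA mulVf ?gt_eqF// scale1r -ler_pdivrMl ?invr_gt0// invrK.
Qed.

(* The functional [slide p a] stays below [p] (take [t = 0]) and satisfies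
   [slide p a (- a) <= - p a] (take [t = 1]), so that a sublinear functional
   which it cannot decrease is odd, hence linear. *)
Definition slide_values p a x : set R :=
  [set p (x + t *: a) - t * p a | t in [set t | 0 <= t]].

Definition slide p a x : R := inf (slide_values p a x).

Lemma slide_values_lb p a x : sublinear p ->
  lbound (slide_values p a x) (- p (- x)).
Proof.
move=> sp _ [t t0 <-]; have := sp.1 (- x) (x + t *: a).
by rewrite addKr sp.2//; lra.
Qed.

Lemma slide_le p a x t : sublinear p -> 0 <= t ->
  slide p a x <= p (x + t *: a) - t * p a.
Proof.
move=> sp t0; apply: ge_inf; last by exists t.
by exists (- p (- x)); exact: slide_values_lb.
Qed.

Lemma slide_ge p a x b :
  (forall t, 0 <= t -> b <= p (x + t *: a) - t * p a) -> b <= slide p a x.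
Proof.
move=> h; apply: lb_le_inf.
  by exists (p (x + 0 *: a) - 0 * p a); exists 0 => //=.
by move=> _ [t t0 <-]; exact: h.
Qed.

Lemma slide_le_id p a x : sublinear p -> slide p a x <= p x.
Proof.
by move=> sp; have := slide_le a x sp (lexx 0);
  rewrite scale0r addr0 mul0r subr0.
Qed.

Lemma slide_opp p a : sublinear p -> slide p a (- a) <= - p a.
Proof.
move=> sp; have := slide_le a (- a) sp ler01.
by rewrite scale1r addNr (sublinear0 sp) mul1r sub0r.
Qed.

(** For subadditivity, parameters [s] for [x] and [t] for [y] give the parameter [s + t] for
    [x + y]; for homogeneity, the parameter [s] for [x] becomes [t * s] for [t *: x]. *)
Lemma slide_sublinear p a : sublinear p -> sublinear (slide p a).
Proof.
move=> sp; apply: sublinearP.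
- apply/eqP; rewrite eq_le; apply/andP; split.
    by rewrite -[leRHS](sublinear0 sp) slide_le_id.
  by apply: slide_ge => t t0; rewrite add0r sp.2// subrr.
- move=> x y; rewrite -lerBlDr; apply: slide_ge => s s0.
  rewrite lerBlDr -lerBlDl; apply: slide_ge => t t0.
  rewrite lerBlDl; apply: le_trans (slide_le a (x + y) sp (addr_ge0 s0 t0)) _.
  have := sp.1 (x + s *: a) (y + t *: a).
  by rewrite addrACA -scalerDl; lra.
- move=> t x t0; rewrite -ler_pdivrMl//; apply: slide_ge => s s0.
  rewrite ler_pdivrMl//.
  have := slide_le a (t *: x) sp (mulr_ge0 (ltW t0) s0).
  by rewrite -scalerA -scalerDr (sp.2 _ _ (ltW t0)) -mulrA -mulrBr.
Qed.

(* Chains in the set of sublinear functionals below [p] have their pointwise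
   infimum as a lower bound. *)
Lemma minimal_sublinear p : sublinear p ->
  exists q, [/\ sublinear q, forall x, q x <= p x &
    forall r, sublinear r -> (forall x, r x <= q x) -> r = q].
Proof.
move=> sp.
pose below q := sublinear q /\ forall x, q x <= p x.
pose T := {q : V -> R | below q}.
(* The order is reversed, so that a maximal element for Zorn's lemma is a minimal functional. *)
pose le (q r : T) : bool := `[< forall x, sval r x <= sval q x >].
have [|||A totA|[q [sq qp]] qmin] := @Zorn T le.
- by move=> q; apply/asboolP.
- move=> q r s /asboolP qr /asboolP rs; apply/asboolP => x.
  exact: le_trans (rs x) (qr x).
- move=> [q hq] [r hr] /asboolP/= qr /asboolP/= rq; apply: eq_exist.
  by apply/funext => x; apply/eqP; rewrite eq_le qr rq.
(* The empty chain is treated apart, with [p] itself as bound, since [inf] of the empty set is only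
   a default value. *)
- have [[q0 Aq0]|A0] := pselect (exists q, A q); last first.
    exists (exist below p (conj sp (fun=> lexx _))) => q Aq.
    by exfalso; apply: A0; exists q.
  pose vals x : set R := [set sval q x | q in A].
  (* The bound [- p (- x) <= - q (- x) <= q x] does not depend on [q], so the pointwise infimum is
     finite. *)
  have vals_lb x : lbound (vals x) (- p (- x)).
    move=> _ [[q [sq qp]] _ <-] /=.
    by apply: le_trans (sublinear_opp x sq); rewrite lerN2.
  have inf_le q x : A q -> inf (vals x) <= sval q x.
    by move=> Aq; apply: ge_inf; [exists (- p (- x))|exists q].
  have inf_ge x b : (forall q, A q -> b <= sval q x) -> b <= inf (vals x).
    move=> h; apply: lb_le_inf; first by exists (sval q0 x), q0.
    by move=> _ [q Aq <-]; exact: h.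
  have sinf : sublinear (fun x => inf (vals x)).
    apply: sublinearP.
    + apply/eqP; rewrite eq_le; apply/andP; split.
        by apply: le_trans (inf_le _ _ Aq0) _; rewrite (sublinear0 (svalP q0).1).
      by apply: (inf_ge) => q _; rewrite (sublinear0 (svalP q).1).
    + move=> x y; rewrite -lerBlDr; apply: (inf_ge) => q Aq.
      rewrite lerBlDr -lerBlDl; apply: (inf_ge) => r Ar; rewrite lerBlDl.
      (* The smaller of [q] and [r], evaluated at [x + y], is at most [q x + r y]. *)
      have [/asboolP qr|/asboolP rq] := totA _ _ Aq Ar.
      * apply: le_trans (inf_le _ _ Ar) _.
        by apply: le_trans ((svalP r).1.1 _ _) _; rewrite lerD2r.
      * apply: le_trans (inf_le _ _ Aq) _.
        by apply: le_trans ((svalP q).1.1 _ _) _; rewrite lerD2l.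
    + move=> t x t0; rewrite -ler_pdivrMl//; apply: (inf_ge) => q Aq.
      by rewrite ler_pdivrMl// -((svalP q).1.2 _ _ (ltW t0)); exact: (inf_le).
  have infp x : inf (vals x) <= p x.
    exact: le_trans (inf_le _ _ Aq0) ((svalP q0).2 x).
  exists (exist below _ (conj sinf infp)) => q Aq; apply/asboolP => x /=.
  exact: (inf_le).
- exists q; split=> // r sr rq.
  have rp x : r x <= p x := le_trans (rq x) (qp x).
  have leqr : le (exist below q (conj sq qp)) (exist below r (conj sr rp)).
    exact/asboolP.
  by have /(congr1 sval) := qmin _ leqr.
Qed.

Lemma minimal_sublinear_opp q : sublinear q ->
  (forall r, sublinear r -> (forall x, r x <= q x) -> r = q) ->
  forall x, q (- x) = - q x.
Proof.
move=> sq qmin x; apply/eqP; rewrite eq_le; apply/andP; split; last first.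
  by rewrite lerNl sublinear_opp.
have := slide_opp x sq.
by rewrite (qmin _ (slide_sublinear x sq) (fun y => slide_le_id x y sq)).
Qed.

(** Oddness turns subadditivity at [- x] and [- y] into superadditivity at [x] and [y], and carries
    homogeneity over to negative scalars. *)
Lemma sublinear_odd_linear q : sublinear q ->
  (forall x, q (- x) = - q x) -> scalar q.
Proof.
move=> sq qN.
have qD x y : q (x + y) = q x + q y.
  apply/eqP; rewrite eq_le sq.1/= -lerN2 opprD -!qN opprD; exact: sq.1.
move=> t x y; rewrite qD; congr (_ + _).
have [t0|/ltW t0] := leP 0 t; first exact: sq.2.
by rewrite -[t in LHS]opprK scaleNr qN sq.2 ?oppr_ge0// mulNr opprK.
Qed.

(** The minimal functional [q] is taken below [slide p a] instead of [p]: then [q (- a) <= - p a],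
    and oddness gives [p a <= q a]. *)
Lemma hahn_banach_touching p a : sublinear p ->
  exists u : V -> R, [/\ scalar u, forall x, u x <= p x & u a = p a].
Proof.
move=> sp; have [q [sq qle qmin]] := minimal_sublinear (slide_sublinear a sp).
have qN := minimal_sublinear_opp sq qmin.
have qp x : q x <= p x := le_trans (qle x) (slide_le_id a x sp).
exists q; split=> //; first exact: sublinear_odd_linear.
apply/eqP; rewrite eq_le qp/= -lerN2 -qN.
exact: le_trans (qle _) (slide_opp a sp).
Qed.

End Sublinear.

(** * Restriction of scalars to the reals *)

Definition realification (R : realType) (V : lmodType R[i]) : Type := V.

Section Realification.
Context {R : realType} {V : lmodType R[i]}.

(** The real structure lives on an alias of [V], so that it does not clash with the complex one
    while functions on [V] can be reused as they are. *)
Let rscale (t : R) (x : realification V) : realification V := t%:C *: (x : V).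

Let rscaleA s t x : rscale s (rscale t x) = rscale (s * t) x.
Proof. by rewrite /rscale scalerA -rmorphM. Qed.

Let rscale1 : left_id 1 rscale.
Proof. by move=> x; rewrite /rscale rmorph1 scale1r. Qed.

Let rscaleDr : right_distributive rscale +%R.
Proof. by move=> t x y; rewrite /rscale scalerDr. Qed.

Let rscaleDl x : {morph rscale^~ x : s t / s + t}.
Proof. by move=> s t; rewrite /rscale rmorphD scalerDl. Qed.

HB.instance Definition _ := GRing.Zmodule.on (realification V).
HB.instance Definition _ := GRing.Zmodule_isLmodule.Build R (realification V)
  rscaleA rscale1 rscaleDr rscaleDl.

Lemma realification_scaleE t (x : realification V) : t *: x = t%:C *: (x : V).
Proof. by []. Qed.

End Realification.

(** * The real-valued norm and unimodular scalars *)

Section Nrm.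
Context {R : realType} {V : normedModType R[i]}.
Implicit Types (x y : V).

Lemma nrmE x : `|x| = (nrm x)%:C.
Proof. by rewrite RRe_real// normr_real. Qed.

Lemma nrm_ge0 x : 0 <= nrm x.
Proof. by rewrite -lecR -nrmE normr_ge0. Qed.

Lemma nrmD x y : nrm (x + y) <= nrm x + nrm y.
Proof. by rewrite -lecR rmorphD /= -!nrmE ler_normD. Qed.

Lemma nrmN x : nrm (- x) = nrm x.
Proof. by rewrite /nrm normrN. Qed.

End Nrm.

Section NrmScale.
Context {R : realType}.
Implicit Types (a : R[i]).

Lemma nrmZ (V : normedModType R[i]) a (x : V) :
  nrm (a *: x) = nrm (a : R[i]^o) * nrm x.
Proof. by apply: complexI; rewrite rmorphM /= -!nrmE normrZ. Qed.

Lemma nrm_real (t : R) : nrm (t%:C : R[i]^o) = `|t|.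
Proof. by apply: complexI; rewrite -nrmE normc_def/= expr0n addr0 sqrtr_sqr. Qed.

Lemma Re_le_nrm a : complex.Re a <= nrm (a : R[i]^o).
Proof.
rewrite -lecR -nrmE; apply: le_trans (normc_ge_Re a).
by rewrite lecR ler_norm.
Qed.

Lemma polar_unit a : exists2 c : R[i], `|c| = 1 & c * a = (nrm (a : R[i]^o))%:C.
Proof.
have [->|a0] := eqVneq a 0.
  by exists 1; rewrite ?normr1// mulr0 -nrmE normr0.
exists (`|a| / a); last by rewrite -nrmE divfK.
by rewrite normrM normfV normr_id divff// normr_eq0.
Qed.

End NrmScale.

(** * Norming functionals on a complex space *)

Section NormingFunctional.
Context {R : realType} {F : normedModType R[i]}.

Lemma sublinear_nrm : sublinear (@nrm R F : realification F -> R).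
Proof.
split=> [x y|t x t0]; first exact: nrmD.
by rewrite realification_scaleE nrmZ nrm_real ger0_norm.
Qed.

(** If [psi] is complex linear with real part [u], then [psi ('i *: x) = 'i * psi x] forces the
    imaginary part at [x] to be [- u ('i *: x)]. *)
Definition complexify (u : F -> R) (x : F) : R[i]^o := u x +i* - u ('i *: x).

Lemma complexify_scalar (u : realification F -> R) :
  scalar u -> scalar (complexify u).
Proof.
move=> ul.
have uC t x y : u (t%:C *: x + y : F) = t * u x + u y by exact: ul.
have cE (s t : R) : s +i* t = s%:C + t%:C * 'i by simpc.
move=> [s t] x y; rewrite /complexify.
(* Both arguments of [u] are rewritten as combinations with real coefficients, to which [uC]
   applies. *)
have -> : (s +i* t) *: x + y = s%:C *: x + (t%:C *: ('i *: x) + y).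
  by rewrite cE scalerDl scalerA addrA.
have -> : 'i *: (s%:C *: x + (t%:C *: ('i *: x) + y)) =
    s%:C *: ('i *: x) + ((- t)%:C *: x + 'i *: y).
  rewrite !scalerDr !scalerA.
  by congr (_ *: _ + (_ *: _ + _)); [rewrite mulrC|simpc].
rewrite !uC; simpc; congr (_ +i* _); ring.
Qed.

(** A unimodular [c] makes [psi (c *: x)] real and nonnegative, hence equal to [u (c *: x)], which
    is at most [nrm x]. At [a], [nrm a = u a] is the real part of [psi a]. *)
Lemma norming_functional (a : F) : exists psi : {linear F -> R[i]^o},
  (forall x, nrm (psi x) <= nrm x) /\ nrm (psi a) = nrm a.
Proof.
have [u [ul u_le ua]] :=
  hahn_banach_touching (a : realification F) sublinear_nrm.
pose l := GRing.isLinear.Build _ _ _ _ (complexify u) (complexify_scalar ul).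
pose psi : {linear F -> R[i]^o} := HB.pack (complexify u) l.
have psi_le x : nrm (psi x) <= nrm x.
  have [c c1 /(congr1 (@complex.Re R)) /= cpsi] := polar_unit (psi x).
  have -> : nrm x = nrm (c *: x) by rewrite nrmZ {2}/nrm c1 mul1r.
  rewrite -cpsi; have -> : c * psi x = psi (c *: x) by rewrite linearZ.
  exact: u_le.
exists psi; split=> //; apply/eqP; rewrite eq_le psi_le/=.
by rewrite -ua; exact: (Re_le_nrm (psi a)).
Qed.

End NormingFunctional.

(** Linearity reduces differentiability to continuity, which follows from boundedness. *)
Lemma nrm_contraction_differentiable (R : realType) (F G : normedModType R[i])
    (psi : {linear F -> G}) (x : F) :
  (forall y, nrm (psi y) <= nrm y) -> differentiable psi x.
Proof.
move=> psi_le; apply: linear_differentiable; apply: bounded_linear_continuous.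
apply/linear_boundedP; near=> r => y.
apply: (@le_trans _ _ `|y|); first by rewrite !nrmE lecR.
by apply: ler_peMl => //; near: r; exact: nbhs_pinfty_ge.
Unshelve. all: by end_near. Qed.

Lemma nrm_unit_exists (R : realType) (F : normedModType R[i]) (x : F) :
  x != 0 -> exists y : F, nrm y = 1.
Proof.
move=> x0; exists ((nrm x)^-1%:C *: x).
have nx0 : nrm x != 0.
  by apply: contra_neq x0 => nx; apply/normr0_eq0; rewrite nrmE nx.
by rewrite nrmZ nrm_real ger0_norm ?invr_ge0 ?nrm_ge0// mulVf.
Qed.

(** * Weighted spaces of holomorphic mappings *)

Section WeightedSpace.
Context {R : realType} {E : normedModType R[i]} {U : set E} {v : E -> R}.
Context (weight_v : weight U v).

Lemma le_wnorm (F : normedModType R[i]) (f : E -> F) z :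
  Hinf U v f -> U z -> v z * nrm (f z) <= wnorm U v f.
Proof. by move=> [_ fb] Uz; apply: ub_le_sup => //; exists z. Qed.

(** On an empty [U] the default value 0 of [sup] could exceed a negative [b]. *)
Lemma wnorm_le (F : normedModType R[i]) (f : E -> F) b : U !=set0 ->
  (forall z, U z -> v z * nrm (f z) <= b) -> wnorm U v f <= b.
Proof.
move=> [z Uz] fb; apply: ge_sup; first by exists (v z * nrm (f z)), z.
by move=> _ [w Uw <-]; exact: fb.
Qed.

Lemma HinfB (F : normedModType R[i]) (f g : E -> F) :
  Hinf U v f -> Hinf U v g -> Hinf U v (f \- g).
Proof.
move=> Hf Hg; split=> [z Uz|].
  by apply: differentiableB; [exact: Hf.1|exact: Hg.1].
exists (wnorm U v f + wnorm U v g) => _ [z Uz <-] /=.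
apply: le_trans (lerD (le_wnorm Hf Uz) (le_wnorm Hg Uz)).
rewrite -mulrDr ler_wpM2l ?(ltW (weight_v.1 _ Uz))//.
by apply: le_trans (nrmD _ _) _; rewrite nrmN.
Qed.

Lemma Hinf_dominated (F G : normedModType R[i]) (f : E -> F) (g : E -> G) :
  Hinf U v f -> holomorphic_on U g ->
  (forall z, U z -> nrm (g z) <= nrm (f z)) -> Hinf U v g.
Proof.
move=> Hf hg gf; split=> //; exists (wnorm U v f) => _ [z Uz <-].
apply: le_trans (le_wnorm Hf Uz).
by rewrite ler_wpM2l ?(ltW (weight_v.1 _ Uz))// gf.
Qed.

Lemma Hinf_scale_vector (F : normedModType R[i]) (f : E -> R[i]^o) (y : F) :
  nrm y = 1 -> Hinf_sphere U v f -> Hinf_sphere U v (fun z => f z *: y).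
Proof.
move=> y1 [Hf f1].
have fy z : nrm (f z *: y) = nrm (f z) by rewrite nrmZ y1 mulr1.
split; last by rewrite -f1 /wnorm /wvalues; under eq_fun do rewrite fy.
apply: (Hinf_dominated Hf) => [z Uz|z _]; last by rewrite fy.
by apply: differentiableZl; exact: Hf.1.
Qed.

End WeightedSpace.

(** * Transfer of the property from [F] to the scalars *)

Theorem proposition2p1 (R : realType) (E : completeNormedModType R[i])
    (U : set E) (v : E -> R)
    (openU : open U) (weight_v : weight U v)
    (BPB_F : exists F : completeNormedModType R[i],
       (exists y : F, y != 0) /\ WHinf_BPB F U v) :
  WHinf_BPB R[i]^o U v.
Proof.
case: BPB_F => F [[y' y'0] bpb] eps /andP[eps0 eps1].
have [y y1] := nrm_unit_exists y'0.
have [|eta /andP[eta0 eta_lt] {}bpb] := bpb (eps / 2); first by lra.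
exists eta; first by apply/andP; split; lra.
move=> f lambda z Sf lambda1 Uz fz.
have U0 : U !=set0 by exists z.
have [|f0 [lambda0 [z0 [[Sf0 lambda01 Uz0] [f0z0 ff0 dd]]]]] :=
  bpb _ lambda z (Hinf_scale_vector weight_v y1 Sf) lambda1 Uz.
  by rewrite nrmZ y1 mulr1.
have [psi [psi_le psi_f0z0]] := norming_functional (f0 z0).
have [c c1 cpsi] := polar_unit (psi y).
have nc : nrm (c : R[i]^o) = 1 by rewrite /nrm c1.
set d := wnorm U v _ in ff0.
have HB : Hinf U v ((fun z => f z *: y) \- f0).
  apply: HinfB => //; last exact: Sf0.1.
  exact: (Hinf_scale_vector weight_v y1 Sf).1.
pose h := psi \o (c *: f0).
have hE w : h w = c *: psi (f0 w) by rewrite /h/= linearZ.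
have h_le w : nrm (h w) <= nrm (f0 w) by rewrite hE nrmZ nc mul1r.
have Hh : Hinf U v h.
  apply: (Hinf_dominated weight_v Sf0.1) => // w Uw.
  apply: differentiable_comp; first by apply: differentiableZ; exact: Sf0.1.1.
  exact: nrm_contraction_differentiable.
have vh0 : v z0 * nrm (h z0) = 1 by rewrite hE nrmZ nc mul1r psi_f0z0.
have h1 : wnorm U v h = 1.
  apply/eqP; rewrite eq_le -{2}vh0 (le_wnorm Hh Uz0) andbT.
  apply: (wnorm_le U0) => w Uw; rewrite -[leRHS]Sf0.2.
  apply: le_trans (le_wnorm Sf0.1 Uw).
  by rewrite ler_wpM2l ?(ltW (weight_v.1 _ Uw)).
(* The map [c *: psi] does not increase norms, and it sends [f w *: y - f0 w] to this difference
   because [c * psi y = nrm (psi y)]. *)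
have fh w : U w -> v w * nrm ((nrm (psi y))%:C *: f w - h w) <= d.
  move=> Uw; apply: le_trans (le_wnorm HB Uw).
  rewrite ler_wpM2l ?(ltW (weight_v.1 _ Uw))//=.
  have -> : (nrm (psi y))%:C *: f w - h w = c *: psi (f w *: y - f0 w).
    rewrite linearB linearZ hE scalerBr; congr (_ - _).
    by rewrite -[in LHS]cpsi /GRing.scale/= mulrAC mulrA.
  by rewrite nrmZ nc mul1r.
have fle w : U w -> v w * nrm (f w) <= 1.
  by move=> Uw; rewrite -[leRHS]Sf.2; exact: le_wnorm Sf.1 Uw.
have psi_y1 : nrm (psi y) <= 1 by rewrite -y1.
(* Since [v z0 * |f z0| <= 1 = v z0 * |h z0|], closeness at [z0] forces
   [psi y] to be almost of modulus 1. *)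
have psi_y : 1 - nrm (psi y) <= d.
  have := nrmD ((nrm (psi y))%:C *: f z0) (h z0 - (nrm (psi y))%:C *: f z0).
  rewrite [X in nrm X]addrCA subrr addr0 -opprB nrmN nrmZ.
  rewrite nrm_real ger0_norm ?nrm_ge0// -(ler_pM2l (weight_v.1 _ Uz0)) vh0.
  rewrite mulrDr mulrCA => le1; rewrite lerBlDl; apply: le_trans le1 _.
  by apply: lerD; [rewrite ler_piMr ?nrm_ge0// fle|exact: fh].
(* [lambda0] and [z0] are kept: the norm comparing the two evaluations involves scalar functions
   only, whatever [F] is. *)
exists h, lambda0, z0; split; first by split.
split=> //; last by lra.
apply: (@le_lt_trans _ _ (1 - nrm (psi y) + d)); last by lra.
apply: (wnorm_le U0) => w Uw.
(* The first summand has weighted norm at most [1 - nrm (psi y)] because [f] has norm 1; the second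
   is bounded by [fh]. *)
have -> : (f \- h) w =
    (1 - nrm (psi y))%:C *: f w + ((nrm (psi y))%:C *: f w - h w).
  by rewrite addrA -scalerDl -rmorphD subrK scale1r.
apply: le_trans (ler_wpM2l (ltW (weight_v.1 _ Uw)) (nrmD _ _)) _.
rewrite mulrDr; apply: lerD; last exact: fh.
rewrite nrmZ nrm_real ger0_norm ?subr_ge0// mulrCA.
by rewrite ler_piMr ?subr_ge0// fle.
Qed.
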